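(* Let $\lambda\in\left(0,\frac29\right)$ be a real number, and let $\hat{x}$ be the smallest real root of the cubic polynomial $\lambda-\frac32x(1-x)^2$ in $x$. Then there is a constant $C=C(\lambda)$ such that for every positive integer $n$, with $m=\lceil\lambda n\rceil$, \[ T(n,m)\le\left(\frac32\right)^n\frac{C}{2^{-\hat{x}n}\binom{n}{\lceil\hat{x}n\rceil-1}}. \]
   Context: Three words $x,y,z\in\{0,1,2\}^n$ triffer at position $i$ if $\{x_i,y_i,z_i\}=\{0,1,2\}$. For integers $n\ge m\ge 1$, a code $C\subseteq\{0,1,2\}^n$ is $m$-trifferent if any three distinct codewords of $C$ triffer in at least $m$ positions. $T(n,m)$ denotes the largest size of an $m$-trifferent code $C\subseteq\{0,1,2\}^n$. *)

(* Defs.v *)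
From HB Require Import structures.
From mathcomp Require Import all_boot all_order all_algebra.
From mathcomp Require Import all_classical all_reals all_analysis.

Set Implicit Arguments.
Unset Strict Implicit.
Unset Printing Implicit Defensive.

Import Order.TTheory GRing.Theory Num.Theory.

Local Open Scope ring_scope.

Definition word (n : nat) := n.-tuple 'I_3.

Definition triffer (n : nat) (x y z : word n) (i : 'I_n) : bool :=
  [set tnth x i; tnth y i; tnth z i]%SET == [set: 'I_3]%SET.

Definition trifferent (n m : nat) (C : {set word n}) : bool :=
  [forall x in C, forall y in C, forall z in C,
    [&& x != y, y != z & x != z] ==>
    (m <= #|[set i : 'I_n | triffer x y z i]%SET|)%N].

(* The maximum ranges over a nonempty family: the empty code is always
   m-trifferent. *)
Definition T (n m : nat) : nat :=
  \max_(C : {set word n} | trifferent m C) #|C|.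

Definition cubic (R : realType) (lambda : R) : {poly R} :=
  lambda%:P - (3 / 2)%:P * 'X * (1 - 'X) ^+ 2.

Definition smallest_root (R : realType) (p : {poly R}) (x : R) : Prop :=
  root p x /\ forall y : R, root p y -> x <= y.

(* Main.v *)
Require Import Defs.
From HB Require Import structures.
From mathcomp Require Import all_boot all_order all_algebra.
From mathcomp Require Import all_classical all_reals all_analysis.
From mathcomp Require Import ring lra zify.

Import Order.TTheory GRing.Theory Num.Theory.

Local Open Scope ring_scope.

(** Elias-Bassalygo double counting with an exponential gain.  Choose a word y at
    random and keep the codewords that agree with y in exactly t positions.  At
    t = xhat n the mean number of triffering positions over triples of such a
    list is at most 3/2 xhat (1 - xhat)^2 n = lambda n, and this alone loses a
    factor n.  Instead t is taken slightly beyond the threshold,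
    t = (xhat + eps) n, which makes the Hamming shell larger by a factor
    rho^(eps n), rho > 1.  All triples of the list then triffer in a number of
    positions within O(eps n) of the maximal mean.  Averaging over the third
    word turns this into a statement on pairs: after double centring, the words
    become vectors of squared norm of order n with pairwise inner products
    at most O(eps n).  Comparing a high odd moment of the inner products
    (nonnegative) with an even one (bounded below by the Welch bound) shows that
    there are at most exp(o(eps) n) such vectors, which is less than the gain
    rho^(eps n) for small eps. *)

(** * Moments of inner products and the Welch bound *)

Lemma sqr_sum_le (R : realFieldType) (A : finType) (P : {set A}) (U : A -> R) :
  (\sum_(a in P) U a) ^+ 2 <= #|P|%:R * \sum_(a in P) U a ^+ 2.
Proof.
have : 0 <= \sum_(a in P) \sum_(b in P) (U a - U b) ^+ 2.
  by apply: sumr_ge0 => a _; apply: sumr_ge0 => b _; rewrite sqr_ge0.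
have -> : \sum_(a in P) \sum_(b in P) (U a - U b) ^+ 2 =
   \sum_(a in P) \sum_(b in P) (U a ^+ 2 + U b ^+ 2 - 2 * (U a * U b)).
  by apply: eq_bigr => a _; apply: eq_bigr => b _; ring.
under eq_bigr => a _.
  rewrite sumrB big_split /= sumr_const -mulr_sumr -mulr_sumr.
  over.
rewrite /= sumrB big_split /= sumr_const -sumrMnl -mulr_sumr -mulr_suml -mulr_natl.
rewrite sumrMnl -mulr_natl expr2; lra.
Qed.

Section Moments.
Variables (R : realFieldType) (I J : finType) (v : J -> I -> R).

Definition gram (j j' : J) : R := \sum_i v j i * v j' i.

(** Coordinate [h] of the k-th tensor power of the vector [v j]. *)
Let monom (k : nat) (j : J) (h : {ffun 'I_k -> I}) : R := \prod_l v j (h l).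

Lemma sum_expn (f : I -> R) (k : nat) :
  (\sum_i f i) ^+ k = \sum_(h : {ffun 'I_k -> I}) \prod_l f (h l).
Proof.
rewrite -[in LHS](card_ord k) -prodr_const.
rewrite (eq_bigl xpredT)//.
by rewrite bigA_distr_bigA.
Qed.

Lemma gram_expn (k : nat) (j j' : J) :
  gram j j' ^+ k = \sum_(h : {ffun 'I_k -> I}) monom k j h * monom k j' h.
Proof. by rewrite sum_expn; apply: eq_bigr => h _; rewrite -big_split. Qed.

(** The k-th powers of the inner products are the inner products of the k-th tensor powers, so the
    double sum is the squared norm of the sum of these tensors. *)
Lemma sum_gram_expn_ge0 (S : {set J}) (k : nat) :
  0 <= \sum_(j in S) \sum_(j' in S) gram j j' ^+ k.
Proof.
have -> : \sum_(j in S) \sum_(j' in S) gram j j' ^+ k =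
   \sum_(h : {ffun 'I_k -> I}) (\sum_(j in S) monom k j h) ^+ 2.
  under eq_bigr => j _.
    under eq_bigr => j' _ do rewrite gram_expn.
    rewrite exchange_big /=.
    under eq_bigr => h _ do rewrite -mulr_sumr.
    over.
  rewrite exchange_big /=; apply: eq_bigr => h _.
  by rewrite -mulr_suml expr2.
by apply: sumr_ge0 => h _; rewrite sqr_ge0.
Qed.

(** The exponent vector of a monomial. Counts never exceed [k], so [inord] does not truncate. *)
Definition histogram (k : nat) (h : {ffun 'I_k -> I}) : {ffun I -> 'I_k.+1} :=
  [ffun i => inord #|[set l | h l == i]%SET|].

Lemma histogramE (k : nat) (h : {ffun 'I_k -> I}) (i : I) :
  histogram k h i = #|[set l | h l == i]%SET| :> nat.
Proof.
rewrite ffunE inordK// ltnS.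
by rewrite -[X in (_ <= X)%N](card_ord k) max_card.
Qed.

Lemma monom_histogram (k : nat) (j : J) (h : {ffun 'I_k -> I}) :
  monom k j h = \prod_i v j i ^+ histogram k h i.
Proof.
rewrite /monom (partition_big h xpredT)//=; apply: eq_bigr => i _.
rewrite (eq_bigr (fun=> v j i)); last by move=> l /eqP ->.
by rewrite prodr_const histogramE; congr (_ ^+ _); apply: eq_card => l; rewrite inE.
Qed.

Lemma sum_histogram (k : nat) (h : {ffun 'I_k -> I}) :
  (\sum_i histogram k h i)%N = k.
Proof.
under eq_bigr => i _ do rewrite histogramE -sum1dep_card.
rewrite -[RHS](card_ord k) -sum1_card [RHS](partition_big h xpredT)//.
Qed.

Definition histograms (k : nat) : {set {ffun I -> 'I_k.+1}} :=
  [set a : {ffun I -> 'I_k.+1} | (\sum_i a i)%N == k]%SET.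

(** Generating function argument: every histogram of total [k] has weight [z ^+ k], and the total
    weight of all exponent vectors factors into truncated geometric series. *)
Lemma card_histograms_le (k : nat) (z : R) : 0 < z < 1 ->
  #|histograms k|%:R * z ^+ k <= (1 - z)^-1 ^+ #|I|.
Proof.
move=> /andP[z0 z1].
have z1' : 0 < 1 - z by rewrite subr_gt0.
have -> : #|histograms k|%:R * z ^+ k =
    \sum_(a in histograms k) \prod_i z ^+ a i :> R.
  rewrite (eq_bigr (fun=> z ^+ k)); last first.
    by move=> a; rewrite inE => /eqP ak; rewrite prodrXr ak.
  by rewrite sumr_const mulr_natl.
apply: (@le_trans _ _ (\sum_(a : {ffun I -> 'I_k.+1}) \prod_i z ^+ a i)).
  rewrite [leRHS](bigID (mem (histograms k)))/= lerDl.
  by apply: sumr_ge0 => a _; apply: prodr_ge0 => i _; rewrite exprn_ge0// ltW.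
rewrite -(bigA_distr_bigA (fun (_ : I) (j : 'I_k.+1) => z ^+ j)) prodr_const.
rewrite (eq_card (B := I))//; apply: lerXn2r.
- by rewrite nnegrE sumr_ge0// => j _; rewrite exprn_ge0// ltW.
- by rewrite nnegrE invr_ge0 ltW.
rewrite -[leRHS]mul1r ler_pdivlMr// mulrC -[leLHS]opprK -mulNr opprB -subrX1.
by rewrite opprB gerBl exprn_ge0// ltW.
Qed.

(* Symmetric tensor form of the Welch bound: the monomials of degree k only
   depend on their histogram, so Cauchy-Schwarz is applied to the histograms
   instead of the #|I|^k monomials. *)
Lemma welch_bound (S : {set J}) (k : nat) :
  (\sum_(j in S) gram j j ^+ k) ^+ 2 <=
    #|histograms k|%:R * \sum_(j in S) \sum_(j' in S) gram j j' ^+ (2 * k).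
Proof.
pose u (h : {ffun 'I_k -> I}) := \sum_(j in S) monom k j h ^+ 2.
pose U a := \sum_(h | histogram k h == a) u h.
have -> : \sum_(j in S) gram j j ^+ k = \sum_(a in histograms k) U a.
  under eq_bigr => j _ do rewrite gram_expn.
  rewrite exchange_big /=.
  rewrite (partition_big (histogram k) (mem (histograms k)))/=; last first.
    by move=> h _; rewrite inE sum_histogram.
  by apply: eq_bigr => a _; apply: eq_bigr => h _; apply: eq_bigr => j _; rewrite expr2.
have -> : \sum_(j in S) \sum_(j' in S) gram j j' ^+ (2 * k) =
    \sum_h \sum_h' (\sum_(j in S) monom k j h * monom k j h') ^+ 2.
  transitivity (\sum_(j in S) \sum_(j' in S) \sum_h \sum_h'
     (monom k j h * monom k j h') * (monom k j' h * monom k j' h')).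
    apply: eq_bigr => j _; apply: eq_bigr => j' _.
    rewrite mulnC exprM gram_expn expr2 mulr_suml; apply: eq_bigr => h _.
    by rewrite mulr_sumr; apply: eq_bigr => h' _; ring.
  under eq_bigr => j _ do rewrite exchange_big /=.
  rewrite exchange_big /=; apply: eq_bigr => h _.
  under eq_bigr => j _ do rewrite exchange_big /=.
  rewrite exchange_big /=; apply: eq_bigr => h' _.
  rewrite expr2 mulr_suml; apply: eq_bigr => j _.
  by rewrite mulr_sumr.
(* Monomials with the same histogram coincide, so the square of [U a] is the part of the double sum
   with both [h] and [h'] over [a]. The remaining pairs are squares and are dropped. *)
have UE a : U a ^+ 2 = \sum_(h | histogram k h == a) \sum_(h' | histogram k h' == a)
    (\sum_(j in S) monom k j h * monom k j h') ^+ 2.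
  rewrite expr2 mulr_suml; apply: eq_bigr => h /eqP ha.
  rewrite mulr_sumr; apply: eq_bigr => h' /eqP h'a.
  have hh' j : monom k j h' = monom k j h by rewrite !monom_histogram ha h'a.
  rewrite /u expr2; congr (_ * _); apply: eq_bigr => j _; rewrite hh' ?expr2//.
apply: (le_trans (sqr_sum_le _ _ _ _)); apply: ler_wpM2l; first exact: ler0n.
under eq_bigr => a _ do rewrite UE.
rewrite [leRHS](partition_big (histogram k) (mem (histograms k)))/=; last first.
  by move=> h _; rewrite inE sum_histogram.
apply: ler_sum => a _; apply: ler_sum => h _.
rewrite [leRHS](bigID (fun h' => histogram k h' == a))/= lerDl.
by apply: sumr_ge0 => h' _; rewrite sqr_ge0.
Qed.

(* The odd moment is nonnegative, so the negative inner products are on average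
   no larger than the positive ones, which are at most e. *)
Lemma card_spread_le (S : {set J}) (k : nat) (r e : R) :
    0 <= r -> 0 <= e ->
    (forall j, j \in S -> r <= gram j j <= 1) ->
    (forall j j', j \in S -> j' \in S -> j != j' -> gram j j' <= e) ->
  #|S|%:R * r ^+ (2 * k.+1) <=
    #|histograms k.+1|%:R * (2 * (1 + #|S|%:R * e ^+ (2 * k).+1)).
Proof.
move=> r0 e0 hd hoff.
have [->|S0] := posnP #|S|; first by rewrite !mul0r addr0 !mulr1 mulr_ge0.
have S0' : 0 < #|S|%:R :> R by rewrite ltr0n.
rewrite -(ler_pM2l S0').
pose b (j j' : J) : R := if j == j' then 1 else e.
have gram_abs j j' : j \in S -> j' \in S -> `|gram j j'| <= 1.
  move=> jS j'S; have /andP[_ hj] := hd _ jS; have /andP[_ hj'] := hd _ j'S.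
  have p1 : 0 <= \sum_i (v j i + v j' i) ^+ 2.
    by apply: sumr_ge0 => i _; rewrite sqr_ge0.
  have p2 : 0 <= \sum_i (v j i - v j' i) ^+ 2.
    by apply: sumr_ge0 => i _; rewrite sqr_ge0.
  have e1 : \sum_i (v j i + v j' i) ^+ 2 = gram j j + gram j' j' + 2 * gram j j'.
    by rewrite /gram mulr_sumr -!big_split; apply: eq_bigr => i _ /=; ring.
  have e2 : \sum_i (v j i - v j' i) ^+ 2 = gram j j + gram j' j' - 2 * gram j j'.
    by rewrite /gram mulr_sumr -big_split -sumrB; apply: eq_bigr => i _ /=; ring.
  rewrite ler_norml; lra.
(* As the inner products are at most 1 in absolute value, the even power is at most the preceding
   odd power of the absolute value, which is twice the positive part minus the signed power. The
   signed powers sum to a nonnegative number and drop out. *)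
have abs_odd j j' : j \in S -> j' \in S ->
    gram j j' ^+ (2 * k.+1) <= 2 * b j j' ^+ (2 * k).+1 - gram j j' ^+ (2 * k).+1.
  move=> jS j'S; have g1 := gram_abs _ _ jS j'S.
  have b0 : 0 <= b j j' by rewrite /b; case: eqP.
  have gb : gram j j' <= b j j'.
    rewrite /b; case: eqP => [_|/eqP jj']; last exact: hoff.
    by rewrite (le_trans (ler_norm _)).
  apply: (@le_trans _ _ (`|gram j j'| ^+ (2 * k).+1)).
    rewrite -(ger0_norm (exprn_even_ge0 (n := 2 * k.+1) _ _)) ?mul2n ?odd_double//.
    by rewrite normrX doubleS; apply: ler_wiXn2l.
  case: (lerP 0 (gram j j')) => g0.
    have : gram j j' ^+ (2 * k).+1 <= b j j' ^+ (2 * k).+1 by apply: lerXn2r.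
    rewrite ger0_norm//; lra.
  rewrite ltr0_norm// exprNn -signr_odd /= mul2n odd_double /= expr1 mulN1r.
  have : 0 <= b j j' ^+ (2 * k).+1 by rewrite exprn_ge0.
  rewrite mul2n; lra.
have U : \sum_(j in S) \sum_(j' in S) gram j j' ^+ (2 * k.+1) <=
    #|S|%:R * (2 * (1 + #|S|%:R * e ^+ (2 * k).+1)).
  apply: (@le_trans _ _ (\sum_(j in S) \sum_(j' in S) 2 * b j j' ^+ (2 * k).+1)).
    rewrite -subr_ge0 -sumrB.
    apply: (le_trans (sum_gram_expn_ge0 S (2 * k).+1)); apply: ler_sum => j jS.
    rewrite -sumrB; apply: ler_sum => j' j'S.
    have := abs_odd _ _ jS j'S; lra.
  rewrite [leRHS]mulr_natl -sumr_const; apply: ler_sum => j jS.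
  rewrite -mulr_sumr ler_pM2l// (bigD1 j)//= /b eqxx expr1n lerD2l.
  rewrite (eq_bigr (fun=> e ^+ (2 * k).+1)); last first.
    by move=> j' /andP[_ /negPf]; rewrite eq_sym => ->.
  rewrite mulr_natl -sumr_const [leRHS](bigD1 j)//= lerDr exprn_ge0//.
apply: (@le_trans _ _ ((\sum_(j in S) gram j j ^+ k.+1) ^+ 2)).
  have -> : #|S|%:R * (#|S|%:R * r ^+ (2 * k.+1)) = (#|S|%:R * r ^+ k.+1) ^+ 2.
    by rewrite mulnC exprM; ring.
  have L : #|S|%:R * r ^+ k.+1 <= \sum_(j in S) gram j j ^+ k.+1.
    rewrite mulr_natl -sumr_const; apply: ler_sum => j jS.
    by have /andP[h _] := hd _ jS; apply: lerXn2r; rewrite ?nnegrE// (le_trans r0).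
  have P0 : 0 <= #|S|%:R * r ^+ k.+1 by rewrite mulr_ge0// exprn_ge0.
  by apply: lerXn2r; rewrite ?nnegrE// (le_trans P0).
apply: (le_trans (welch_bound _ _)).
rewrite mulrCA; exact: ler_wpM2l.
Qed.

End Moments.

Arguments gram {R I J} v j j'.

(** * Counting histograms at an explicit weight *)

Lemma bernoulli_ineq (R : realFieldType) (h : R) (n : nat) :
  -1 <= h -> 1 + n%:R * h <= (1 + h) ^+ n.
Proof.
move=> h1; elim: n => [|n IH]; first by rewrite mul0r addr0 expr0.
have H : 0 <= (1 + h) * ((1 + h) ^+ n - (1 + n%:R * h)).
  by apply: mulr_ge0; [lra | rewrite subr_ge0].
have n0 : 0 <= n%:R * (h * h) by rewrite mulr_ge0 ?ler0n// -expr2 sqr_ge0.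
rewrite exprS -natr1; nra.
Qed.

Lemma card_histograms_half (R : realFieldType) (I : finType) (n P k : nat) :
  #|I| = (2 * n)%N -> (0 < P)%N -> (n < k.+1 * (2 * P))%N ->
  #|histograms I k|%:R <= 16 ^+ k.+1 * (2 * P%:R) ^+ k :> R.
Proof.
move=> cI P0 nk; have P0' : 1 <= P%:R :> R by rewrite ler1n.
(* With this weight [(1 - z)^-1 ^+ P <= 2], and [2 * n] is at most [P * (4 * k.+1)], whence the
   factor 2 ^ 4 = 16 per degree. *)
pose z : R := (2 * P%:R)^-1.
have z0 : 0 < z by rewrite invr_gt0; lra.
have zP : z * (2 * P%:R) = 1 by rewrite mulVf// gt_eqF//; lra.
have z1 : z <= 1 / 2 by nra.
have z01 : 0 < z < 1 by rewrite z0; lra.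
have -> : (2 * P%:R) ^+ k = (z ^+ k)^-1 :> R by rewrite /z exprVn invrK.
rewrite ler_pdivlMr ?exprn_gt0//.
apply: (le_trans (card_histograms_le _ _ _ _ z01)).
have half : (1 - z)^-1 ^+ P <= 2 :> R.
  rewrite exprVn invf_ple ?posrE ?exprn_gt0//; last lra.
  apply: le_trans (bernoulli_ineq _ (- z) P _); nra.
have i1 : 1 <= (1 - z)^-1 by rewrite invf_ge1; lra.
rewrite cI; apply: (@le_trans _ _ ((1 - z)^-1 ^+ (P * (4 * k.+1)))).
  by apply: ler_weXn2l => //; nia.
rewrite exprM (_ : 16 = 2 ^+ 4); last by ring.
by rewrite -[leRHS]exprM; apply: lerXn2r; rewrite ?nnegrE ?exprn_ge0//; lra.
Qed.

(** * Laws of a single letter: the quadratic form and its stability *)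

Definition spread (s t r : 'I_3) : bool := [&& s != t, t != r & s != r].

Section Letters.
Variable R : rcfType.
Implicit Types (q : 'I_3 -> R) (s t r : 'I_3).

Let a1 : 'I_3 := lift ord0 ord0.
Let a2 : 'I_3 := lift ord0 (lift ord0 ord0).

Lemma ord3_ind (P : 'I_3 -> Prop) : P ord0 -> P a1 -> P a2 -> forall s, P s.
Proof.
move=> p0 p1 p2; case=> -[|[|[|//]]] h.
- by rewrite (_ : Ordinal h = ord0)//; apply: val_inj.
- by rewrite (_ : Ordinal h = a1)//; apply: val_inj.
- by rewrite (_ : Ordinal h = a2)//; apply: val_inj.
Qed.

Lemma sum_ord3 (f : 'I_3 -> R) : \sum_s f s = f ord0 + f a1 + f a2.
Proof. by rewrite !big_ord_recl big_ord0 addr0 addrA. Qed.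

(* Probability that a random letter of law q completes s, t to three distinct
   letters. *)
Definition complete q s t : R := \sum_r (spread s t r)%:R * q r.

Definition complete1 q s : R := \sum_t complete q s t * q t.

(** Probability that three independent letters of law [q] are pairwise distinct. *)
Definition complete2 q : R := \sum_s complete1 q s * q s.

Lemma complete2E q : complete2 q = 6 * q ord0 * q a1 * q a2.
Proof. rewrite /complete2 /complete1 /complete !sum_ord3 /spread /=; ring. Qed.

Lemma complete_ge0 q s t : (forall r, 0 <= q r) -> 0 <= complete q s t.
Proof. by move=> q0; apply: sumr_ge0 => r _; rewrite mulr_ge0 ?ler0n. Qed.

Lemma complete_le1 q s t : (forall r, 0 <= q r) -> \sum_r q r = 1 ->
  complete q s t <= 1.
Proof.
move=> q0 <-; apply: ler_sum => r _.
by rewrite -[leRHS]mul1r ler_wpM2r//; case: spread.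
Qed.

Lemma complete_diag q s : complete q s s = 0.
Proof. by rewrite /complete big1// => r _; rewrite /spread eqxx mul0r. Qed.

(* Double centring of -complete q with respect to q. *)
Definition centred q s t : R :=
  complete1 q s + complete1 q t - complete2 q - complete q s t.

(** Makes [- complete q] positive semidefinite on vectors of coordinate sum 0: both coefficients of
    its diagonal form are nonnegative, the second one here multiplied by [q ord0]. *)
Definition psd_letter q : bool :=
  (0 < q ord0) && ((q a1 - q a2) ^+ 2 <= q ord0 * (2 - 3 * q ord0)).

(** The two linear forms of the diagonalisation, scaled by the square roots of their coefficients
    and evaluated at the indicator of [s] minus [q]. *)
Definition feature q s (b : bool) : R :=
  let d1 := (s == a1)%:R - q a1 in let d2 := (s == a2)%:R - q a2 in
  if b then Num.sqrt (q ord0 / 2) *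
              (d1 - d2 + (d1 + d2) * (q a2 - q a1) / q ord0)
  else Num.sqrt ((2 - 3 * q ord0 - (q a1 - q a2) ^+ 2 / q ord0) / 2) * (d1 + d2).

(* On vectors with coordinate sum 0 the form -complete q is, with
   S = d1 + d2 and U = d1 - d2,
   (q0/2) (U + S (q2 - q1)/q0)^2 + (1/2) (2 - 3 q0 - (q1 - q2)^2/q0) S^2. *)
Lemma centred_feature q s t : psd_letter q -> \sum_r q r = 1 ->
  centred q s t = \sum_b feature q s b * feature q t b.
Proof.
move=> /andP[q0 qc] q1.
have sq1 : Num.sqrt (q ord0 / 2) ^+ 2 = q ord0 / 2 by rewrite sqr_sqrtr//; lra.
have sq2 : Num.sqrt ((2 - 3 * q ord0 - (q a1 - q a2) ^+ 2 / q ord0) / 2) ^+ 2 =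
    (2 - 3 * q ord0 - (q a1 - q a2) ^+ 2 / q ord0) / 2.
  by rewrite sqr_sqrtr// divr_ge0// subr_ge0 ler_pdivrMr// mulrC.
rewrite big_bool /feature.
move: sq1 sq2; set w1 := Num.sqrt _; set w2 := Num.sqrt _ => sq1 sq2.
rewrite [X in _ = X + _]mulrACA -[w1 * w1]expr2 sq1.
rewrite [X in _ = _ + X]mulrACA -[w2 * w2]expr2 sq2.
rewrite /centred complete2E /complete1 /complete.
move: q1; rewrite !sum_ord3 => q1.
have -> : q a1 = 1 - q ord0 - q a2 by rewrite -q1; ring.
have q00 : q ord0 != 0 by rewrite gt_eqF.
by elim/ord3_ind: s; elim/ord3_ind: t; rewrite /spread /=; field.
Qed.

(* 3/2 of it is the gap between complete2 q and the tangent line at p = x of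
   3/2 p (1 - p)^2, the value of complete2 for the law (p, (1-p)/2, (1-p)/2). *)
Definition defect (x : R) q : R :=
  (q ord0 - x) ^+ 2 * (2 - 2 * x - q ord0) + q ord0 * (q a1 - q a2) ^+ 2.

Lemma complete2_defect (x : R) q : \sum_r q r = 1 ->
  complete2 q = 3 / 2 * x * (1 - x) ^+ 2 +
    3 / 2 * (1 - x) * (1 - 3 * x) * (q ord0 - x) - 3 / 2 * defect x q.
Proof.
rewrite complete2E /defect sum_ord3 => q1.
have -> : q ord0 = 1 - q a1 - q a2 by rewrite -q1; ring.
by field.
Qed.

Lemma defect_ge0 (x : R) q : 0 < x < 1 / 3 ->
  (forall r, 0 <= q r) -> \sum_r q r = 1 -> 0 <= defect x q.
Proof.
move=> xb q0; rewrite sum_ord3 => q1.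
have h0 := q0 ord0; have h1 := q0 a1; have h2 := q0 a2.
by rewrite addr_ge0// mulr_ge0// ?sqr_ge0//; lra.
Qed.

(** Either [q ord0] is at distance at least x/2 from x and the first term of the defect is large, or
    [q ord0] lies between x/2 and 3x/2 and failure of [psd_letter] forces [q a1] and [q a2] far
    apart. *)
Lemma defect_ge (x : R) q : 0 < x < 1 / 3 ->
  (forall r, 0 <= q r) -> \sum_r q r = 1 -> ~~ psd_letter q ->
  x ^+ 2 / 12 <= defect x q.
Proof.
move=> xb q0; rewrite sum_ord3 negb_and => q1 bad.
have h0 := q0 ord0; have h1 := q0 a1; have h2 := q0 a2.
have [far|near] := lerP (x ^+ 2 / 4) ((q ord0 - x) ^+ 2).
  have := sqr_ge0 (q a1 - q a2).
  rewrite /defect => H.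
  have : 0 <= q ord0 * (q a1 - q a2) ^+ 2 by rewrite mulr_ge0.
  have : x ^+ 2 / 4 * (1 / 3) <= (q ord0 - x) ^+ 2 * (2 - 2 * x - q ord0).
    by apply: ler_pM => //; [rewrite divr_ge0 ?sqr_ge0 | lra].
  lra.
have [l u] : x / 2 < q ord0 /\ q ord0 < 3 * x / 2 by split; nra.
move: bad; rewrite -leNgt -ltNge => /orP[|bad]; first lra.
have := sqr_ge0 (q ord0 - x); rewrite /defect => H.
have : 0 <= (q ord0 - x) ^+ 2 * (2 - 2 * x - q ord0) by rewrite mulr_ge0//; lra.
have : x / 2 * (x / 4) <= q ord0 * (q a1 - q a2) ^+ 2.
  apply: ler_pM; try lra.
  apply: le_trans (ltW bad); nra.
nra.
Qed.

End Letters.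

Arguments complete {R} q s t.
Arguments complete1 {R} q s.
Arguments complete2 {R} q.
Arguments psd_letter {R} q.
Arguments feature {R} q s b.
Arguments defect {R} x q.

(** * From a list of words to nearly orthogonal vectors *)

Section ListDecoding.
Variables (R : rcfType) (J : finType) (n : nat) (a : J -> 'I_n -> 'I_3).
Variables (L : {set J}) (x eta lam : R).

Let M : R := #|L|%:R.

Hypothesis hn : (0 < n)%N.
Hypothesis hx : 0 < x < 1 / 3.
Hypothesis hlam : lam = 3 / 2 * x * (1 - x) ^+ 2.
Hypothesis heta : 0 < eta.
Hypothesis hM : 1 <= M * eta.
Hypothesis ha : forall j, j \in L ->
  #|[set i | a j i == ord0]%SET|%:R <= (x + eta) * n%:R.
Hypothesis htri : forall j j' j'', j \in L -> j' \in L -> j'' \in L ->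
  j != j' -> j' != j'' -> j != j'' ->
  lam * n%:R <= #|[set i | spread (a j i) (a j' i) (a j'' i)]%SET|%:R.

Let letter_law (i : 'I_n) (r : 'I_3) : R := M^-1 * \sum_(j in L) (a j i == r)%:R.
Local Notation q := letter_law.

Let good (i : 'I_n) : bool := psd_letter (q i).
(** Number of positions where [j] and [j'] triffer with a third word, averaged over that word in the
    list. [Fg], [g] and [A] are this quantity and its successive means restricted to good
    positions. *)
Let F (j j' : J) : R := \sum_i complete (q i) (a j i) (a j' i).
Let Fg (j j' : J) : R := \sum_(i | good i) complete (q i) (a j i) (a j' i).
Let g (j : J) : R := \sum_(i | good i) complete1 (q i) (a j i).
Let A : R := \sum_(i | good i) complete2 (q i).
Let features (j : J) (ib : 'I_n * bool) : R :=
  if good ib.1 then feature (q ib.1) (a j ib.1) ib.2 else 0.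
(** The term with [x] bounds the proportion of bad positions; of the [4 * eta], one [eta] is the
    loss in [F_ge] and three are slack. *)
Let gamma : R := (4 + 36 / x ^+ 2) * eta.

Let M_gt0 : 0 < M.
Proof.
rewrite ltNge; apply/negP => M0.
have : M * eta <= 0 by rewrite mulr_le0_ge0// ltW.
have := hM; lra.
Qed.

Let Minv_le : M^-1 <= eta.
Proof. by rewrite -[leLHS]mul1r ler_pdivrMr// mulrC. Qed.

Let Minv_gt0 : 0 < M^-1.
Proof. by rewrite invr_gt0. Qed.

Let law_ge0 i r : 0 <= q i r.
Proof. by rewrite mulr_ge0 ?(ltW Minv_gt0)//; apply: sumr_ge0. Qed.

Let avgE (i : 'I_n) (h : 'I_3 -> R) :
  M^-1 * \sum_(j in L) h (a j i) = \sum_r h r * q i r.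
Proof.
under [RHS]eq_bigr => r _ do rewrite mulrCA mulr_sumr.
rewrite -mulr_sumr exchange_big /=; congr (_ * _); apply: eq_bigr => j _.
rewrite (bigD1 (a j i))//= eqxx mulr1 big1 ?addr0// => r.
by rewrite eq_sym => /negPf ->; rewrite mulr0.
Qed.

Let law_sum i : \sum_r q i r = 1.
Proof.
have := avgE i (fun=> 1); rewrite sumr_const mulVf ?gt_eqF// => ->.
by apply: eq_bigr => r _; rewrite mul1r.
Qed.

Let lam_bounds : 0 < lam /\ lam < 2 / 9.
Proof.
have xb := hx; have x1 : 0 < 1 - x by lra.
rewrite hlam; split; first by rewrite !mulr_gt0 ?exprn_gt0//; lra.
have : 0 < (x - 1 / 3) ^+ 2 * (4 / 3 - x).
  by rewrite mulr_gt0//; [rewrite exprn_even_gt0//= lt_eqF//; lra | lra].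
nra.
Qed.

Let n_ge0 : 0 <= n%:R :> R. Proof. exact: ler0n. Qed.

(** Only the third words [j] and [j'] escape [htri]; they cost 2 lam / M, which is below [eta]
    because lam < 2/9 and [M * eta >= 1]. *)
Let F_ge j j' : j \in L -> j' \in L -> j != j' -> (lam - eta) * n%:R <= F j j'.
Proof.
move=> jL j'L jj'.
have -> : F j j' = M^-1 * \sum_(j'' in L) \sum_i (spread (a j i) (a j' i) (a j'' i))%:R.
  rewrite exchange_big /= mulr_sumr; apply: eq_bigr => i _.
  by rewrite (avgE i (fun r => (spread (a j i) (a j' i) r)%:R)).
rewrite [leRHS]mulrC ler_pdivlMr//.
have nn := n_ge0; have := lam_bounds => -[l0 l1].
apply: (@le_trans _ _ ((M - 2) * (lam * n%:R))).
  have : 0 <= (M * eta - 1) * n%:R by rewrite mulr_ge0// subr_ge0.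
  have : lam * n%:R <= 2 / 9 * n%:R by rewrite ler_wpM2r// ltW.
  lra.
have -> : (M - 2) * (lam * n%:R) =
    \sum_(j'' in L)
      (lam * n%:R - (j'' == j)%:R * (lam * n%:R) - (j'' == j')%:R * (lam * n%:R)).
  rewrite !sumrB sumr_const -!mulr_suml (bigD1 j)//= eqxx big1; last first.
    by move=> k /andP[_ /negPf ->].
  rewrite (bigD1 j')//= eqxx big1; last by move=> k /andP[_ /negPf ->].
  by rewrite -[_ *+ #|L|]mulr_natl /M /=; ring.
apply: ler_sum => k kL.
have s0 i : 0 <= \sum_l (spread (a j l) (a j' l) (a i l))%:R :> R by apply: sumr_ge0.
have ln0 : 0 <= lam * n%:R by rewrite mulr_ge0// ltW.
have [->|kj] := eqVneq k j; first by rewrite (negPf jj') mul1r mul0r subrr subr0.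
have [->|kj'] := eqVneq k j'; first by rewrite mul1r mul0r subr0 subrr.
rewrite !mul0r !subr0; apply: le_trans (htri _ _ _ jL j'L kL jj' _ _) _.
- by rewrite eq_sym.
- by rewrite eq_sym.
by rewrite -sum1dep_card natr_sum big_mkcond /=; apply: ler_sum => i _; case: spread.
Qed.

(** Sum over positions of the tangent line identity [complete2_defect]: by [ha] the mean of
    [q i ord0] is at most x + eta, and the slope lies between 0 and 3/2. *)
Let avg2_le : \sum_i complete2 (q i) <=
  lam * n%:R + 3 / 2 * eta * n%:R - 3 / 2 * \sum_i defect x (q i).
Proof.
have q0 : \sum_i q i ord0 <= (x + eta) * n%:R.
  rewrite -mulr_sumr exchange_big /= mulrC ler_pdivrMr//.
  rewrite [leRHS]mulrC /M [leRHS]mulr_natl -sumr_const; apply: ler_sum => j jL.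
  apply: le_trans (ha j jL).
  by rewrite -sum1dep_card natr_sum [leRHS]big_mkcond /=; apply: ler_sum => i _; case: eqP.
have cst (c : R) : \sum_(i < n) c = c * n%:R by rewrite sumr_const card_ord mulr_natr.
have -> : \sum_i complete2 (q i) = lam * n%:R +
    3 / 2 * (1 - x) * (1 - 3 * x) * (\sum_i q i ord0 - x * n%:R) -
    3 / 2 * \sum_i defect x (q i).
  rewrite -!cst -sumrB !mulr_sumr -big_split -sumrB; apply: eq_bigr => i _ /=.
  by rewrite (complete2_defect R x)// hlam.
rewrite lerD2r lerD2l.
have xb := hx; have k0 : 0 <= 3 / 2 * (1 - x) * (1 - 3 * x) by rewrite !mulr_ge0//; lra.
have k1 : 3 / 2 * (1 - x) * (1 - 3 * x) <= 3 / 2 by nra.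
apply: (@le_trans _ _ (3 / 2 * (1 - x) * (1 - 3 * x) * (eta * n%:R))).
  by rewrite ler_wpM2l//; lra.
by rewrite -[leRHS]mulrA ler_wpM2r// mulr_ge0// ltW.
Qed.

(** Averages [F_ge] over all pairs; the diagonal pairs cost a second [eta]. *)
Let avg2_ge : (lam - 2 * eta) * n%:R <= \sum_i complete2 (q i).
Proof.
have -> : \sum_i complete2 (q i) = M^-1 * \sum_(j in L) (M^-1 * \sum_(j' in L) F j j').
  under [in RHS]eq_bigr => j _.
    rewrite exchange_big /= mulr_sumr.
    under eq_bigr => i _ do rewrite avgE.
    over.
  rewrite /= [in RHS]exchange_big [in RHS]mulr_sumr; apply: eq_bigr => i _.
  by rewrite (avgE i (complete1 (q i))).
have nn := n_ge0; have := lam_bounds => -[l0 l1].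
rewrite [leRHS]mulrC ler_pdivlMr// [leLHS]mulrC /M [leLHS]mulr_natl -sumr_const.
apply: ler_sum => j jL.
rewrite [leRHS]mulrC ler_pdivlMr//.
apply: (@le_trans _ _ ((M - 1) * ((lam - eta) * n%:R))).
  have : 0 <= (M * eta - 1) * n%:R by rewrite mulr_ge0// subr_ge0.
  have : lam * n%:R <= 2 / 9 * n%:R by rewrite ler_wpM2r// ltW.
  have : 0 <= eta * n%:R by rewrite mulr_ge0// ltW.
  lra.
have -> : (M - 1) * ((lam - eta) * n%:R) =
    \sum_(j' in L) ((lam - eta) * n%:R - (j' == j)%:R * ((lam - eta) * n%:R)).
  rewrite !sumrB sumr_const -!mulr_suml (bigD1 j)//= eqxx big1; last first.
    by move=> k /andP[_ /negPf ->].
  by rewrite -[_ *+ #|L|]mulr_natl /M /=; ring.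
apply: ler_sum => k kL.
have [->|kj] := eqVneq k j.
  by rewrite mul1r subrr; apply: sumr_ge0 => i _; apply: complete_ge0.
by rewrite mul0r subr0 F_ge// eq_sym.
Qed.

(** The upper and lower bounds on the mean leave at most [3 * eta * n] for the total defect, and
    each bad position uses up [x ^+ 2 / 12] of it. *)
Let bad_le : \sum_(i | ~~ good i) 1 <= 36 / x ^+ 2 * eta * n%:R :> R.
Proof.
have xb := hx; have x20 : 0 < x ^+ 2 by rewrite exprn_gt0//; lra.
have D : \sum_i defect x (q i) <= 3 * eta * n%:R.
  have := avg2_ge; have := avg2_le.
  have : 0 <= eta * n%:R by rewrite mulr_ge0// ltW.
  lra.
have B : \sum_(i | ~~ good i) x ^+ 2 / 12 <= \sum_i defect x (q i).
  rewrite [leRHS](bigID good) /= -[leLHS]add0r; apply: lerD.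
    by apply: sumr_ge0 => i _; apply: defect_ge0.
  by apply: ler_sum => i bi; apply: defect_ge.
have -> : \sum_(i | ~~ good i) 1 = 12 / x ^+ 2 * \sum_(i | ~~ good i) (x ^+ 2 / 12) :> R.
  rewrite mulr_sumr; apply: eq_bigr => i _; field; lra.
apply: (@le_trans _ _ (12 / x ^+ 2 * (3 * eta * n%:R))); last first.
  by rewrite le_eqVlt; apply/orP; left; apply/eqP; field; lra.
by apply: ler_wpM2l; [rewrite divr_ge0// ltW | apply: le_trans D].
Qed.

Let Fg_ge j j' : j \in L -> j' \in L -> j != j' ->
  (lam + 3 * eta - gamma) * n%:R <= Fg j j'.
Proof.
move=> jL j'L jj'; have := F_ge _ _ jL j'L jj'.
rewrite /F (bigID good) /= -/(Fg j j').
have : \sum_(i | ~~ good i) complete (q i) (a j i) (a j' i) <= \sum_(i | ~~ good i) 1.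
  by apply: ler_sum => i _; apply: complete_le1.
have := bad_le; rewrite /gamma; lra.
Qed.

Let gE j : g j = M^-1 * \sum_(j' in L) Fg j j'.
Proof.
by rewrite exchange_big /= mulr_sumr; apply: eq_bigr => i _; rewrite avgE.
Qed.

Let AE : A = M^-1 * \sum_(j in L) g j.
Proof.
by rewrite exchange_big /= mulr_sumr; apply: eq_bigr => i _; rewrite avgE.
Qed.

Let gram_features j j' : gram features j j' = g j + g j' - A - Fg j j'.
Proof.
rewrite /g /A /Fg -big_split -!sumrB /= /gram.
rewrite -(pair_big xpredT xpredT (fun i b => features j (i, b) * features j' (i, b))) /=.
rewrite [RHS]big_mkcond /=; apply: eq_bigr => i _.
rewrite /features /=; have [gi|_] := boolP (good i).
  by rewrite -(centred_feature R (q i) (a j i) (a j' i) gi)// law_sum.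
by rewrite big1// => b _; rewrite mul0r.
Qed.

(** Bounding inner products from above requires [g j] not much above its mean [A]. Since
    [g j - A + 2 * gamma * n] is nonnegative with mean [2 * gamma * n], Markov's inequality gives
    this for at least half of the list. *)
Lemma list_features : gamma <= lam / 6 ->
  exists S : {set J}, exists v : J -> 'I_n * bool -> R,
  [/\ S \subset L, #|L|%:R <= 2 * #|S|%:R :> R,
      forall j, j \in S -> lam / 2 * n%:R <= gram v j j <= n%:R &
      forall j j', j \in S -> j' \in S -> j != j' ->
        gram v j j' <= 6 * gamma * n%:R].
Proof.
move=> gl; have [l0 l1] := lam_bounds.
have en0 : 0 <= eta * n%:R by rewrite mulr_ge0// ltW.
have Fgd j : Fg j j = 0 by rewrite /Fg big1// => i _; rewrite complete_diag.
have xb := hx; have x20 : 0 < 36 / x ^+ 2 by rewrite divr_gt0// exprn_gt0//; lra.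
have gam0 : 4 * eta <= gamma by rewrite /gamma; have := ltW (mulr_gt0 x20 heta); lra.
have gn0 : 4 * eta * n%:R <= gamma * n%:R by rewrite ler_wpM2r.
have ln0 : 0 <= lam * n%:R by rewrite mulr_ge0// ltW.
have gln : gamma * n%:R <= lam / 6 * n%:R by rewrite ler_wpM2r.
have lnn : lam * n%:R <= 2 / 9 * n%:R by rewrite ler_wpM2r// ltW.
have A_le : A <= (lam + gamma) * n%:R.
  have : A <= \sum_i complete2 (q i).
    rewrite [leRHS](bigID good) /= lerDl; apply: sumr_ge0 => i _.
    rewrite complete2E; apply: mulr_ge0 => //; apply: mulr_ge0 => //.
    exact: mulr_ge0.
  have := avg2_le.
  have : 0 <= \sum_i defect x (q i) by apply: sumr_ge0 => i _; apply: defect_ge0.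
  lra.
have g_ge j : j \in L -> (lam - gamma) * n%:R <= g j.
  move=> jL; rewrite gE [leRHS]mulrC ler_pdivlMr//.
  apply: (@le_trans _ _ ((M - 1) * ((lam + 3 * eta - gamma) * n%:R))).
    have : 0 <= (M * eta - 1) * n%:R by rewrite mulr_ge0// subr_ge0.
    lra.
  have -> : (M - 1) * ((lam + 3 * eta - gamma) * n%:R) =
      \sum_(j' in L) ((lam + 3 * eta - gamma) * n%:R -
         (j' == j)%:R * ((lam + 3 * eta - gamma) * n%:R)).
    rewrite !sumrB sumr_const -!mulr_suml (bigD1 j)//= eqxx big1; last first.
      by move=> k /andP[_ /negPf ->].
    by rewrite -[_ *+ #|L|]mulr_natl /M /=; ring.
  apply: ler_sum => k kL.
  have [->|kj] := eqVneq k j; first by rewrite mul1r subrr Fgd.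
  by rewrite mul0r subr0 Fg_ge// eq_sym.
pose S := [set j in L | g j <= A + 2 * gamma * n%:R]%SET.
exists S, features; have SL j : j \in S -> j \in L by rewrite inE => /andP[].
have gS j : j \in S -> g j <= A + 2 * gamma * n%:R by rewrite inE => /andP[].
split.
- by apply/fintype.subsetP.
- have gn1 : 0 < gamma * n%:R.
    by rewrite mulr_gt0 ?ltr0n// (lt_le_trans _ gam0)// mulr_gt0.
  have MA : M * A = \sum_(j in L) g j by rewrite AE mulrA mulfV ?gt_eqF// mul1r.
  have : \sum_(j in L) (g j - A + 2 * gamma * n%:R) = M * (2 * gamma * n%:R).
    rewrite big_split sumrB /= !sumr_const.
    rewrite -[X in _ - X]mulr_natl -[X in _ + X]mulr_natl -/M.
    by rewrite MA subrr add0r.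
  rewrite (big_setID S) /= (finset.setIidPr _); last by apply/fintype.subsetP.
  have : 0 <= \sum_(j in S) (g j - A + 2 * gamma * n%:R).
    apply: sumr_ge0 => j /SL /g_ge; lra.
  have : #|L :\: S|%SET%:R * (4 * gamma * n%:R) <=
      \sum_(j in (L :\: S)%SET) (g j - A + 2 * gamma * n%:R).
    rewrite [leLHS]mulr_natl -sumr_const; apply: ler_sum => j.
    rewrite !inE => /andP[/nandP[/negPf->//|]]; rewrite -ltNge; lra.
  rewrite -/M; have -> : M = #|S|%:R + #|(L :\: S)%SET|%:R.
    by rewrite -natrD /M -[in LHS](cardsID S L) (finset.setIidPr _)//; apply/fintype.subsetP.
  move: (#|S|%:R : R) (#|_ :\: S|%:R : R) => u v h1 h2 h3.
  rewrite -(ler_pM2r gn1); lra.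
- move=> j jS; rewrite gram_features Fgd.
  have := g_ge _ (SL _ jS); have := gS _ jS.
  lra.
- move=> j j' jS j'S jj'; rewrite gram_features.
  have := gS _ jS; have := gS _ j'S.
  have := Fg_ge _ _ (SL _ jS) (SL _ j'S) jj'.
  lra.
Qed.

End ListDecoding.

(** * Size of a list *)

Lemma card_list_le (R : rcfType) (J : finType) (n : nat) (a : J -> 'I_n -> 'I_3)
    (L : {set J}) (x eta lam : R) (P k : nat) :
    let e := 6 * ((4 + 36 / x ^+ 2) * eta) in
    let W := 128 * P%:R / lam ^+ 2 in
    (0 < n)%N -> 0 < x < 1 / 3 -> lam = 3 / 2 * x * (1 - x) ^+ 2 -> 0 < eta ->
    e <= lam -> 1 <= #|L|%:R * eta ->
    (forall j, j \in L ->
       #|[set i | a j i == ord0]%SET|%:R <= (x + eta) * n%:R) ->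
    (forall j j' j'', j \in L -> j' \in L -> j'' \in L ->
       j != j' -> j' != j'' -> j != j'' ->
       lam * n%:R <= #|[set i | spread (a j i) (a j' i) (a j'' i)]%SET|%:R) ->
    (0 < P)%N -> (n < k.+2 * (2 * P))%N -> 64 * (W * e ^+ 2) ^+ k.+1 <= e ->
  #|L|%:R <= 128 * W ^+ k.+1.
Proof.
move=> e W hn hx hlam heta hel hM ha htri P0 nk We.
have [lam0 x20] : 0 < lam /\ 0 < x ^+ 2.
  have x1 : 0 < 1 - x by lra.
  by rewrite hlam; split; rewrite ?mulr_gt0 ?exprn_gt0//; lra.
have e0 : 0 < e.
  by rewrite !mulr_gt0// ltr_wpDr// divr_ge0// ltW.
have gl : (4 + 36 / x ^+ 2) * eta <= lam / 6 by rewrite /e in hel; lra.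
have [S [v [SL LS vd vo]]] := list_features _ _ _ _ _ _ _ _ hn hx hlam heta hM ha htri gl.
have n0 : 0 < n%:R :> R by rewrite ltr0n.
(* Rescaling by the square root of n puts squared norms between lam/2 and 1 and inner products below
   [e], as [card_spread_le] requires. *)
pose v' j ib := Num.sqrt (n%:R^-1) * v j ib.
have gv' j j' : gram v' j j' = gram v j j' / n%:R.
  rewrite /gram mulrC mulr_sumr; apply: eq_bigr => i _.
  by rewrite /v' mulrACA -expr2 sqr_sqrtr// invr_ge0 ltW.
have cI : #|{: 'I_n * bool}| = (2 * n)%N by rewrite card_prod card_ord card_bool mulnC.
have vd' j : j \in S -> lam / 2 <= gram v' j j <= 1.
  by move=> jS; rewrite gv' ler_pdivlMr// ler_pdivrMr// mul1r vd.
have vo' j j' : j \in S -> j' \in S -> j != j' -> gram v' j j' <= e.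
  by move=> jS j'S jj'; rewrite gv' ler_pdivrMr//; exact: vo.
have l20 : 0 <= lam / 2 by rewrite divr_ge0// ltW.
have := card_spread_le _ _ _ _ S k _ _ l20 (ltW e0) vd' vo'.
have := card_histograms_half R _ n P k.+1 cI P0 nk.
set D := 16 ^+ _ * _; set H := #|_|%:R => HD main.
have l2k : 0 < (lam / 2) ^+ (2 * k.+1) by rewrite exprn_gt0// divr_gt0.
have DE : D = 16 * W ^+ k.+1 * (lam / 2) ^+ (2 * k.+1).
  have -> : W = 16 * (2 * P%:R) / (lam / 2) ^+ 2 by rewrite /W; field; lra.
  rewrite /D [(lam / 2) ^+ (2 * _)]exprM [16 ^+ _]exprS.
  rewrite [(16 * _ / _) ^+ _]exprMn exprVn [(16 * _) ^+ _]exprMn.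
  by field; rewrite -exprM; apply: lt0r_neq0.
(* By the choice of [W] and the hypothesis on [e], the term in #|S| on the right of the spread bound
   is at most half of the left side, and can be absorbed. *)
have off : 4 * D * e ^+ (2 * k).+1 <= (lam / 2) ^+ (2 * k.+1).
  have -> : 4 * D * e ^+ (2 * k).+1 =
      64 * (W * e ^+ 2) ^+ k.+1 / e * (lam / 2) ^+ (2 * k.+1).
    have ek : e ^+ 2 ^+ k.+1 = e * e ^+ (2 * k).+1 by rewrite -exprM mulnS -exprS.
    by rewrite DE [(W * _) ^+ _]exprMn ek; field; lra.
  by rewrite -[leRHS]mul1r ler_wpM2r// ?(ltW l2k)// ler_pdivrMr// mul1r.
have S0 : 0 <= #|S|%:R :> R by [].
have ek0 : 0 <= e ^+ (2 * k).+1 by rewrite exprn_ge0// ltW.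
have main2 : #|S|%:R * (lam / 2) ^+ (2 * k.+1) <=
    D * (2 * (1 + #|S|%:R * e ^+ (2 * k).+1)).
  apply: le_trans main _; apply: ler_wpM2r => //.
  by rewrite mulr_ge0// addr_ge0// mulr_ge0.
have off2 : #|S|%:R * (4 * D * e ^+ (2 * k).+1) <= #|S|%:R * (lam / 2) ^+ (2 * k.+1).
  exact: ler_wpM2l.
have : #|S|%:R * (lam / 2) ^+ (2 * k.+1) <= 64 * W ^+ k.+1 * (lam / 2) ^+ (2 * k.+1).
  move: off2 main2; rewrite DE; lra.
rewrite ler_pM2r// => SW; lra.
Qed.

(** With s = 2u, the fourth power of Bernoulli's bound for [(1 + h) ^+ u] is of order u ^ 4 and
    dominates the quadratic term once u is large. *)
Lemma exists_sqr_le_exp (R : realType) (h c : R) : 0 < h ->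
  exists2 s : nat, (0 < s)%N & c * s%:R ^+ 2 <= (1 + h) ^+ (2 * s).
Proof.
move=> h0; pose u := (Num.truncn (`|c| * 4 / h ^+ 4)).+1.
exists (2 * u)%N; first by rewrite muln_gt0.
have u1 : 1 <= u%:R :> R by rewrite ler1n.
have hu : `|c| * 4 / h ^+ 4 <= u%:R.
  by apply/ltW/truncnS_gt; rewrite divr_ge0 ?mulr_ge0 ?exprn_ge0// ltW.
have h4 : 0 < h ^+ 4 by rewrite exprn_gt0.
have cu : c * 4 <= h ^+ 4 * u%:R ^+ 2.
  apply: (@le_trans _ _ (`|c| * 4)); first by rewrite ler_wpM2r// ler_norm.
  move: hu; rewrite ler_pdivrMr// => hu; nra.
apply: (@le_trans _ _ ((u%:R * h) ^+ 4)).
  rewrite natrM exprMn [(u%:R * h) ^+ 4]exprMn.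
  have : 0 <= u%:R ^+ 2 * (h ^+ 4 * u%:R ^+ 2 - c * 4).
    by rewrite mulr_ge0 ?exprn_ge0// subr_ge0.
  rewrite -[u%:R ^+ 4]/(u%:R ^+ (2 * 2)) exprM; lra.
rewrite mulnA (_ : (2 * 2 * u = u * 4)%N); last by lia.
rewrite exprM; apply: lerXn2r.
- by rewrite nnegrE mulr_ge0// ltW.
- by rewrite nnegrE exprn_ge0// addr_ge0// ltW.
have := bernoulli_ineq _ h u; lra.
Qed.

(* The list size is at most W^(n / 2P) with P ~ E * s, where W grows only
   polynomially in E and s, so that W <= rho ^ (2 s) can be achieved. *)
Lemma exists_list_bound (R : realType) (x x1 lam rho : R) :
    0 < x < 1 / 3 -> x < x1 -> lam = 3 / 2 * x * (1 - x) ^+ 2 -> 1 < rho ->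
  exists E N : nat, exists B : R, [/\ (0 < E)%N, x + 2 / E%:R <= x1 &
    forall (n : nat) (J : finType) (a : J -> 'I_n -> 'I_3) (L : {set J}),
    (N <= n)%N ->
    (forall j, j \in L ->
       #|[set i | a j i == ord0]%SET|%:R <= (x + 2 / E%:R) * n%:R) ->
    (forall j j' j'', j \in L -> j' \in L -> j'' \in L ->
       j != j' -> j' != j'' -> j != j'' ->
       lam * n%:R <= #|[set i | spread (a j i) (a j' i) (a j'' i)]%SET|%:R) ->
    #|L|%:R <= B * rho ^+ (n %/ E)].
Proof.
move=> hx xx1 hlam rho1.
have [lam0 x20] : 0 < lam /\ 0 < x ^+ 2.
  have x1' : 0 < 1 - x by lra.
  by rewrite hlam; split; rewrite ?mulr_gt0 ?exprn_gt0//; lra.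
pose c := 6 * (4 + 36 / x ^+ 2).
have c0 : 0 < c by rewrite mulr_gt0// ltr_wpDr// divr_ge0// ltW.
(* The three summands serve, in order, for [W * e ^+ 2 <= 1 / 2], for [x + 2 / E <= x1] and for
   [e <= lam]. *)
pose b := (Num.truncn (32 * (32 * c ^+ 2) / lam ^+ 2 + 2 / (x1 - x) + 2 * c / lam)).+1.
have [b1 b2 b3] : [/\ 32 * (32 * c ^+ 2) / lam ^+ 2 <= b%:R,
    2 / (x1 - x) <= b%:R & 2 * c / lam <= b%:R].
  have p1 : 0 <= 32 * (32 * c ^+ 2) / lam ^+ 2.
    rewrite divr_ge0 ?exprn_ge0 ?(ltW lam0)// mulr_ge0// mulr_ge0// exprn_ge0//.
    exact: ltW.
  have p2 : 0 <= 2 / (x1 - x) by rewrite divr_ge0// subr_ge0 ltW.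
  have p3 : 0 <= 2 * c / lam by rewrite divr_ge0 ?(ltW lam0)// mulr_ge0// ltW.
  have : 32 * (32 * c ^+ 2) / lam ^+ 2 + 2 / (x1 - x) + 2 * c / lam < b%:R.
    by apply: truncnS_gt; rewrite !addr_ge0.
  by split; lra.
have b0 : 0 < b%:R :> R by rewrite ltr0n.
have rho0 : 0 < rho - 1 by lra.
have [s s0 hs] := exists_sqr_le_exp R (rho - 1) (128 * b%:R / lam ^+ 2) rho0.
have rhoE : 1 + (rho - 1) = rho by ring.
rewrite rhoE in hs.
pose E := (b * s)%N; pose P := (E * s)%N.
have E0 : (0 < E)%N by rewrite muln_gt0.
have P0 : (0 < P)%N by rewrite muln_gt0 E0.
have s1 : 1 <= s%:R :> R by rewrite ler1n.
have ER : E%:R = b%:R * s%:R :> R by rewrite natrM.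
have PR : P%:R = E%:R * s%:R :> R by rewrite natrM.
have E0' : 0 < E%:R :> R by rewrite ltr0n.
have bE : b%:R <= E%:R :> R by rewrite ER ler_peMr// ltW.
pose e := 6 * ((4 + 36 / x ^+ 2) * (2 / E%:R)).
have eE : e = 2 * c / E%:R by rewrite /e /c; field; lra.
have e0 : 0 < e by rewrite eE divr_gt0// mulr_gt0.
pose W := 128 * P%:R / lam ^+ 2.
have W0 : 0 < W by rewrite /W divr_gt0 ?exprn_gt0// mulr_gt0// ltr0n.
have Ws : W <= rho ^+ (2 * s).
  apply: le_trans hs; rewrite /W PR ER le_eqVlt; apply/orP; left; apply/eqP.
  by field; lra.
have el : e <= lam.
  rewrite eE ler_pdivrMr//; move: b3; rewrite ler_pdivrMr// => b3.
  have : lam * b%:R <= lam * E%:R by rewrite ler_wpM2l// ltW.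
  lra.
have We : W * e ^+ 2 <= 1 / 2.
  have -> : W * e ^+ 2 = 16 * (32 * c ^+ 2) / lam ^+ 2 * (s%:R / E%:R).
    by rewrite /W eE PR; field; rewrite !gt_eqF.
  have -> : s%:R / E%:R = b%:R^-1 :> R by rewrite ER; field; lra.
  by rewrite ler_pdivrMr//; lra.
pose K0 := (Num.truncn (64 / e)).+1.
exists E, (K0 * (2 * P))%N, (128 + E%:R); split => //.
  move: b2; rewrite ler_pdivrMr ?subr_gt0// => b2.
  have : 2 / E%:R <= x1 - x.
    rewrite ler_pdivrMr// (le_trans b2)// mulrC ler_wpM2l// subr_ge0 ltW//.
  lra.
move=> n J a L Nn ha htri.
have rho_ge1 k : 1 <= rho ^+ k by rewrite exprn_ege1// ltW.
(* [card_list_le] is applied with eta = 2 / E; lists too short for its size hypothesis have fewer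
   than E elements. *)
have [small|] := boolP (#|L|%:R * (2 / E%:R) < 1 :> R); last rewrite -leNgt => big.
  have : #|L|%:R <= E%:R :> R.
    move: small; rewrite mulrA ltr_pdivrMr// => small.
    have : 0 <= #|L|%:R :> R by []. by lra.
  have := rho_ge1 (n %/ E)%N; nra.
have P20 : (0 < 2 * P)%N by rewrite mul2n double_gt0.
have n0 : (0 < n)%N by apply: leq_trans Nn; rewrite muln_gt0 P20.
pose K := (n %/ (2 * P))%N.
have K0K : (K0 <= K)%N by rewrite leq_divRL.
have Kpos : (0 < K)%N by apply: leq_trans K0K.
have KS : K = K.-1.+1 by rewrite prednK.
have L1 : #|L|%:R <= 128 * W ^+ K.
  rewrite KS; apply: (card_list_le _ _ _ _ _ _ _ _ _ _ n0 hx hlam _ el big ha htri P0).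
  - by rewrite divr_gt0.
  - by rewrite -KS ltn_ceil.
  rewrite -KS -/W -/e.
  have eK : 64 / e <= K%:R.
    apply: (@le_trans _ _ K0%:R); last by rewrite ler_nat.
    by apply/ltW/truncnS_gt; rewrite divr_ge0// ltW.
  apply: (@le_trans _ _ (64 * (1 / 2) ^+ K)).
    rewrite ler_pM2l//; apply: lerXn2r => //; rewrite nnegrE//.
    by rewrite mulr_ge0 ?exprn_ge0// ltW.
  rewrite div1r exprVn ler_pdivrMr ?exprn_gt0// mulrC -ler_pdivrMr//.
  apply: (le_trans eK); rewrite -natrX ler_nat; exact/ltnW/ltn_expl.
apply: (le_trans L1); apply: ler_pM => //.
- by rewrite exprn_ge0// ltW.
- by rewrite lerDl.
apply: (@le_trans _ _ ((rho ^+ (2 * s)) ^+ K)).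
  by apply: lerXn2r; rewrite ?nnegrE// ?exprn_ge0// ltW// (lt_trans ltr01).
(* The exponents compare because 2 s K E = 2 P K <= n. *)
rewrite -exprM; apply: ler_weXn2l; first exact: ltW.
rewrite leq_divRL//; apply: leq_trans (leq_divM n (2 * P)).
have assoc (u v w : nat) : (2 * u * v * w = v * (2 * (w * u)))%N by ring.
by rewrite -/K assoc.
Qed.

(** * Double counting over Hamming shells *)

(** The letters of [y] are chosen independently, one choice on [A] and two elsewhere: a product over
    positions of sums of indicators, expanded by distributivity. *)
Lemma card_agree_on (n : nat) (c : word n) (A : {set 'I_n}) :
  #|[set y : word n | [set i | tnth c i == tnth y i]%SET == A]%SET| =
    (2 ^ (n - #|A|))%N.
Proof.
have -> : (2 ^ (n - #|A|) =
    \prod_(i < n) \sum_(s : 'I_3) ((tnth c i == s) == (i \in A)) :> nat)%N.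
  transitivity (\prod_(i < n) if i \in A then 1 else 2)%N; last first.
    apply: eq_bigr => i _; case: (i \in A).
      rewrite (bigD1 (tnth c i))//= eqxx big1// => s.
      by rewrite eq_sym => /negPf ->.
    rewrite (bigD1 (tnth c i))//= eqxx (eq_bigr (fun=> 1%N)); last first.
      by move=> s; rewrite eq_sym => /negPf ->.
    rewrite sum1_card add0n (eq_card (B := predC1 (tnth c i)))//.
    by rewrite cardC1 card_ord.
  rewrite (bigID (mem A)) /= big1; last by move=> i ->.
  rewrite mul1n (eq_bigr (fun=> 2%N)); last by move=> i /negPf ->.
  rewrite prod_nat_const; congr (2 ^ _)%N.
  have := cardsC A; rewrite card_ord => cA.
  rewrite [RHS](eq_card (B := ~: A)%SET) => [|i]; last by rewrite [RHS]inE.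
  by rewrite -{1}cA addKn.
rewrite bigA_distr_bigA /= -sum1dep_card big_mkcond /=.
pose f (y : word n) : {ffun 'I_n -> 'I_3} := [ffun i => tnth y i].
pose g (h : {ffun 'I_n -> 'I_3}) : word n := [tuple h i | i < n].
rewrite [RHS](reindex f) /=; last first.
  apply: onW_bij; exists g => [y|h].
    by apply: eq_from_tnth => i; rewrite tnth_mktuple ffunE.
  by apply/ffunP => i; rewrite ffunE tnth_mktuple.
apply: eq_bigr => y _; case: eqP => [<-|neq].
  by rewrite big1// => i _; rewrite inE ffunE eqxx.
have [i hi] : exists i, (tnth c i == tnth y i) != (i \in A).
  apply/existsP; rewrite -negb_forall; apply/negP => /forallP H.
  by apply: neq; apply/setP => i; rewrite inE; exact: (eqP (H i)).
by rewrite (bigD1 i)//= ffunE (negPf hi) mul0n.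
Qed.

Lemma card_agree (n t : nat) (c : word n) :
  #|[set y : word n | #|[set i | tnth c i == tnth y i]%SET| == t]%SET| =
    ('C(n, t) * 2 ^ (n - t))%N.
Proof.
pose agr (y : word n) := [set i | tnth c i == tnth y i]%SET.
rewrite -sum1dep_card (partition_big agr (fun A => #|A| == t))//=.
rewrite -[X in 'C(X, _)](card_ord n) -card_draws -sum_nat_const.
rewrite (eq_bigl (fun A => A \in [set A : {set 'I_n} | #|A| == t]%SET)); last first.
  by move=> A; rewrite inE.
apply: eq_bigr => A; rewrite inE => /eqP At.
rewrite -At -(card_agree_on n c A) -sum1dep_card; apply: eq_bigl => y.
by rewrite -/(agr y); case: (agr y =P A) => [->|]; rewrite ?At ?eqxx ?andbF.
Qed.

(** Counts pairs of a codeword and a centre [y] agreeing in [t] positions: each codeword has the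
    same number of centres, and there are 3 ^ n centres in all. *)
Lemma card_code_list_le (R : realFieldType) (n t : nat) (C : {set word n}) (X : R) :
  (forall y : word n,
     #|[set c in C | #|[set i | tnth c i == tnth y i]%SET| == t]%SET|%:R <= X) ->
  #|C|%:R * ('C(n, t) * 2 ^ (n - t))%:R <= 3 ^+ n * X.
Proof.
move=> HX.
have -> : 3 ^+ n * X = \sum_(y : word n) X.
  by rewrite sumr_const card_tuple card_ord -natrX mulr_natl.
apply: (@le_trans _ _ (\sum_(y : word n)
   #|[set c in C | #|[set i | tnth c i == tnth y i]%SET| == t]%SET|%:R)).
  2: exact: ler_sum.
rewrite -natr_sum -natrM ler_nat.
under eq_bigr => y _ do rewrite -sum1dep_card.
rewrite (exchange_big_dep (mem C))/=; last by move=> y c _ /andP[].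
rewrite -sum_nat_const; apply: leq_sum => c cC.
rewrite -(card_agree n t c) -sum1dep_card.
by rewrite leq_eqVlt; apply/orP; left; apply/eqP; apply: eq_bigl => y; rewrite cC.
Qed.

(** Translating by a letter keeps letters distinct; this lets agreement with a centre become
    occurrence of the letter [ord0]. *)
Lemma triffer_spread (n : nat) (x y z : word n) (i : 'I_n) (u : 'I_3) :
  triffer x y z i -> spread (tnth x i - u) (tnth y i - u) (tnth z i - u).
Proof.
rewrite /triffer /spread !(inj_eq (addIr _)) => /eqP full.
have c3 : #|[set tnth x i; tnth y i; tnth z i]%SET| = 3 by rewrite full cardsT card_ord.
have lt3 (s t : 'I_3) : (#|[set s; t]%SET| < 3)%N by rewrite cards2; case: eqP.
apply/and3P; split; apply/eqP => e; move: c3; rewrite e.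
- by rewrite finset.setUid => c3; have := lt3 (tnth y i) (tnth z i); rewrite c3.
- rewrite -finset.setUA finset.setUid => c3.
  by have := lt3 (tnth x i) (tnth z i); rewrite c3.
- rewrite finset.setUAC finset.setUid => c3.
  by have := lt3 (tnth z i) (tnth y i); rewrite c3.
Qed.

(** * Growth of binomials and location of the root *)

(** Below [y * n] the ratio (n - j) / (j + 1) of consecutive binomials is at least (1 - y) / y = 2
    rho. The factor 2 offsets the halving of 2 ^ (n - t), so each step enlarges the shell by rho. *)
Lemma bin_growth (R : realFieldType) (n k d : nat) (rho y : R) :
  0 < y -> rho = (1 - y) / (2 * y) -> 0 <= rho -> (k + d)%:R <= y * n%:R ->
  (2 * rho) ^+ d * 'C(n, k)%:R <= 'C(n, k + d)%:R.
Proof.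
move=> y0 hrho rho0; elim: d => [|d IH] hd; first by rewrite mul1r addn0.
have hd' : (k + d)%:R + 1 <= y * n%:R by rewrite natr1 -addnS.
have := IH _; rewrite exprS -mulrA => /(_ ltac:(lra)) {}IH.
apply: (@le_trans _ _ (2 * rho * 'C(n, k + d)%:R)).
  by apply: ler_wpM2l; rewrite ?mulr_ge0.
have j0 : 0 < (k + d).+1%:R :> R by rewrite ltr0n.
rewrite addnS -(ler_pM2l j0) -natrM mul_bin_left natrM mulrA ler_wpM2r//.
(* Nonnegative [rho] forces y <= 1, so [k + d] cannot exceed [n] and the natural subtraction is
   exact. *)
have [kn|kn] := leqP (k + d) n; last first.
  have n0 : 0 <= n%:R :> R by [].
  have rE : 2 * rho * y = 1 - y by rewrite hrho; field; lra.
  have y1 : y <= 1.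
    by have := mulr_ge0 (mulr_ge0 (ler0n R 2) rho0) (ltW y0); rewrite rE; lra.
  have : n%:R + 1 <= (k + d)%:R :> R by rewrite natr1 ler_nat.
  nra.
rewrite natrB// -natr1.
have rE : 2 * rho * y = 1 - y by rewrite hrho; field; lra.
have := ler_wpM2l (mulr_ge0 (ler0n R 2) rho0) hd'.
rewrite [leRHS]mulrA rE; lra.
Qed.

(** The cubic is positive for x <= 0 and negative at 1/3, where it equals lam - 2/9, so the
    intermediate value theorem puts a root between. *)
Lemma cubic_smallest_root (R : realType) (lam x : R) : 0 < lam < 2 / 9 ->
  smallest_root (cubic lam) x ->
  0 < x < 1 / 3 /\ lam = 3 / 2 * x * (1 - x) ^+ 2.
Proof.
move=> hl [/rootP rx xmin].
have ev y : (cubic lam).[y] = lam - 3 / 2 * y * (1 - y) ^+ 2.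
  by rewrite /cubic !hornerE.
rewrite ev in rx.
have lamE : lam = 3 / 2 * x * (1 - x) ^+ 2 by lra.
have x0 : 0 < x.
  rewrite ltNge; apply/negP => xle.
  have : 3 / 2 * x * (1 - x) ^+ 2 <= 0 by rewrite mulr_le0_ge0 ?sqr_ge0//; lra.
  lra.
have [||y /andP[y0 y1] ry] := @poly_ivt R (- cubic lam) 0 (1 / 3) _ _.
- by rewrite divr_ge0.
- rewrite !hornerN !ev oppr_le0 oppr_ge0; apply/andP; split; lra.
rewrite rootN in ry; have xy := xmin _ ry.
split => //; rewrite x0 /= lt_neqAle (le_trans xy y1) andbT.
apply/eqP => x3; move: lamE; rewrite x3; lra.
Qed.

(** * Assembling the bound *)

Lemma bin_le_exp2 (n k : nat) : ('C(n, k) <= 2 ^ n)%N.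
Proof.
rewrite -[X in 'C(X, _)](card_ord n) -card_draws.
rewrite (leq_trans (subset_leq_card (finset.subsetT _)))//.
by rewrite -powersetT card_powerset cardsT card_ord.
Qed.

Lemma le_T (R : realFieldType) (n m : nat) (X : R) : 0 <= X ->
  (forall C : {set word n}, trifferent m C -> #|C|%:R <= X) -> (T n m)%:R <= X.
Proof.
move=> X0 HX; rewrite /T; elim/big_ind: _ => // u v hu hv.
by case: (leqP u v).
Qed.

Lemma trifferentP (n m : nat) (C : {set word n}) (x y z : word n) :
  trifferent m C -> x \in C -> y \in C -> z \in C ->
  x != y -> y != z -> x != z ->
  (m <= #|[set i : 'I_n | triffer x y z i]%SET|)%N.
Proof.
move=> /forallP/(_ x)/implyP HC xC yC zC xy yz xz.
have /forallP/(_ y)/implyP/(_ yC)/forallP/(_ z)/implyP/(_ zC)/implyP := HC xC.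
by apply; rewrite xy yz xz.
Qed.

(* Both integers under absz are nonnegative here, since lambda > 0, xhat > 0
   and n > 0. *)
Theorem theorem1p7 (R : realType) (lambda : R) (hlambda : 0 < lambda < 2 / 9)
    (xhat : R) (hxhat : smallest_root (cubic lambda) xhat) :
  exists C : R, forall n : nat, (0 < n)%N ->
    let m := `|Num.ceil (lambda * n%:R)|%N in
    let k := `|Num.ceil (xhat * n%:R) - 1|%N in
    (T n m)%:R <=
      (3 / 2) ^+ n * (C / (2 `^ (- (xhat * n%:R)) * 'C(n, k)%:R)).
Proof.
have [hx hlam] := cubic_smallest_root _ _ _ hlambda hxhat.
(* Any point strictly between xhat and 1/3 gives rho > 1; the midpoint is taken. *)
pose x1 := (xhat + 1 / 3) / 2; pose rho := (1 - x1) / (2 * x1).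
have xx1 : xhat < x1 by rewrite /x1; lra.
have x13 : x1 < 1 / 3 by rewrite /x1; lra.
have x10 : 0 < x1 by lra.
have rho1 : 1 < rho by rewrite /rho ltr_pdivlMr ?mulr_gt0//; lra.
have rho0 : 0 <= rho by lra.
have [E [N [B [E0 xE HB]]]] := exists_list_bound _ _ _ _ _ hx xx1 hlam rho1.
pose N1 := maxn N E.
(* The second summand covers n < N1, where #|C| <= 3 ^ n and the binomial is at most 2 ^ n. *)
exists (`|B| + 4 ^+ N1) => n n0; cbv zeta.
set m := `|Num.ceil (lambda * _)|%N; set k := `|Num.ceil (xhat * _) - 1|%N.
have n0' : 0 < n%:R :> R by rewrite ltr0n.
have kx : k%:R < xhat * n%:R /\ xhat * n%:R <= k%:R + 1.
  have p0 : 0 < xhat * n%:R by rewrite mulr_gt0//; lra.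
  have c0 : 0 <= Num.ceil (xhat * n%:R) - 1.
    by rewrite subr_ge0 -gtz0_ge1 -(ltr_int R) (lt_le_trans p0)// ceil_ge.
  have -> : k%:R = (Num.ceil (xhat * n%:R) - 1)%:~R :> R.
    by rewrite /k natr_absz ger0_norm.
  by rewrite ceilB1_lt intrB subrK ceil_ge.
have [kx1 kx2] := kx.
have kn : (k <= n)%N.
  rewrite -(ler_nat R) (le_trans (ltW kx1))// ler_piMl// ; lra.
set p := 2 `^ _.
have p0 : 0 < p by rewrite powR_gt0.
have pk : p <= 2 ^- k.
  rewrite /p powRN -powR_mulrn// lef_pV2 ?posrE ?powR_gt0//.
  by apply: ler_powR; [lra | exact: ltW].
have bin0 : 0 < 'C(n, k)%:R :> R by rewrite ltr0n bin_gt0.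
have exp2 : 0 < 2 ^+ n :> R by rewrite exprn_gt0.
have exp3 : 0 < 3 ^+ n :> R by rewrite exprn_gt0.
have C0 : 0 <= `|B| + 4 ^+ N1 by rewrite addr_ge0// exprn_ge0.
apply: le_T.
  by rewrite mulr_ge0 ?exprn_ge0 ?divr_ge0// mulr_ge0// ltW.
move=> C HC.
rewrite mulrA ler_pdivlMr ?mulr_gt0// expr_div_n [leRHS]mulrAC ler_pdivlMr//.
have [nN|Nn] := ltnP n N1.
  have C3 : #|C|%:R <= 3 ^+ n :> R.
    rewrite -natrX ler_nat (leq_trans (max_card _))//.
    by rewrite card_tuple card_ord.
  have p1 : p <= 1 by rewrite (le_trans pk)// invf_le1 ?exprn_gt0// exprn_ege1// ler1n.
  have b2 : 'C(n, k)%:R <= 2 ^+ n :> R by rewrite -natrX ler_nat bin_le_exp2.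
  have : #|C|%:R * (p * 'C(n, k)%:R) * 2 ^+ n <= 3 ^+ n * (1 * 2 ^+ n) * 2 ^+ n.
    rewrite ler_pM2r//; apply: ler_pM => //; first by rewrite mulr_ge0// ltW.
    by apply: ler_pM => //; exact: ltW.
  move=> /le_trans; apply; rewrite mul1r -mulrA ler_pM2l// -exprMn.
  have -> : 2 * 2 = 4 :> R by ring.
  apply: (@le_trans _ _ (4 ^+ N1)); last by rewrite lerDr.
  by apply: ler_weXn2l; rewrite ?ler1n// ltnW.
have NN : (N <= n)%N by apply: leq_trans Nn; rewrite leq_maxl.
have En : (E <= n)%N by apply: leq_trans Nn; rewrite leq_maxr.
have E0' : 0 < E%:R :> R by rewrite ltr0n.
(* The shift past [k] gains rho ^ d, enough to pay for the list bound; as E <= n it is at most 2 n /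
   E, so [HB] applies. *)
pose d := (n %/ E).+1; pose t := (k + d)%N.
have tx : t%:R <= (xhat + 2 / E%:R) * n%:R.
  have h1 : (n %/ E)%:R * E%:R <= n%:R :> R by rewrite -natrM ler_nat leq_divM.
  have h2 : E%:R <= n%:R :> R by rewrite ler_nat.
  have h3 : d%:R <= 2 / E%:R * n%:R :> R.
    rewrite [leRHS]mulrAC ler_pdivlMr// /d -natr1; lra.
  rewrite natrD; lra.
have tx1 : t%:R <= x1 * n%:R by apply: (le_trans tx); rewrite ler_wpM2r.
have tn : (t <= n)%N.
  rewrite -(ler_nat R) (le_trans tx1)// ler_piMl//; lra.
have main : #|C|%:R * ('C(n, t) * 2 ^ (n - t))%:R <= 3 ^+ n * (B * rho ^+ (n %/ E)).
  apply: card_code_list_le => y.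
  apply: (HB n _ (fun c i => tnth c i - tnth y i)) => //.
    move=> c; rewrite inE => /andP[_ /eqP ct].
    apply: le_trans tx; rewrite ler_nat -ct.
    rewrite leq_eqVlt; apply/orP; left; apply/eqP; apply: eq_card => i.
    by rewrite !inE subr_eq0.
  move=> c1 c2 c3; rewrite !inE => /andP[C1 _] /andP[C2 _] /andP[C3 _] c12 c23 c13.
  apply: (@le_trans _ _ m%:R).
    rewrite /m natr_absz ger0_norm ?ceil_ge//.
    rewrite -(ler_int R) (le_trans _ (ceil_ge _))// mulr_ge0//.
    by have /andP[/ltW] := hlambda.
  rewrite ler_nat; apply: leq_trans (trifferentP _ _ _ _ _ _ HC C1 C2 C3 c12 c23 c13) _.
  apply: subset_leq_card; apply/fintype.subsetP => i; rewrite !inE.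
  exact: triffer_spread.
have growth := bin_growth R n k d rho x1 x10 erefl rho0 tx1.
have C_ge0 : 0 <= #|C|%:R :> R by [].
have rn : 0 < rho ^+ (n %/ E) by rewrite exprn_gt0//; lra.
have rd : rho ^+ (n %/ E) <= rho ^+ d by apply: ler_weXn2l => //; exact: ltW.
(* The shell gain cancels the factor rho ^ (n / E) of the list size, leaving no loss at level
   [k]. *)
have main2 : #|C|%:R * ('C(n, k)%:R * 2 ^+ (n - k)) <= 3 ^+ n * B.
  rewrite -(ler_pM2r rn) -[leRHS]mulrA; apply: le_trans main.
  rewrite -mulrA ler_wpM2l// natrM natrX.
  apply: (@le_trans _ _ ((2 * rho) ^+ d * 'C(n, k)%:R * 2 ^+ (n - t))).
    have -> : (n - k = d + (n - t))%N by rewrite /t subnDA subnKC// leq_subRL.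
    rewrite [(2 * rho) ^+ d]exprMn [2 ^+ (d + _)]exprD.
    have -> : 2 ^+ d * rho ^+ d * 'C(n, k)%:R * 2 ^+ (n - t) =
      'C(n, k)%:R * (2 ^+ d * 2 ^+ (n - t)) * rho ^+ d :> R by ring.
    by apply: ler_wpM2l => //; rewrite !mulr_ge0 ?exprn_ge0.
  by apply: ler_wpM2r => //; rewrite exprn_ge0.
apply: (@le_trans _ _ (3 ^+ n * B)); last first.
  rewrite ler_pM2l// (le_trans (ler_norm B))// lerDl exprn_ge0//.
apply: le_trans main2; rewrite -mulrA ler_wpM2l//.
rewrite mulrAC mulrC ler_wpM2l ?(ltW bin0)//.
rewrite -(subnKC kn) exprD mulrA.
rewrite -[leRHS]mul1r addKn ler_wpM2r ?exprn_ge0//.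
by rewrite -ler_pdivlMr ?exprn_gt0// div1r.
Qed.
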